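(* Let $n\ge2$ and $A\in M_n(\mathbb C)$. The linear map $X_{A,\cdot}:=X_{A,\operatorname{diag}A}$ is the adjacency operator of a quantum graph on $M_n$ if and only if $A$ is the adjacency matrix of a classical (directed, possibly with loops) graph on $n$ vertices, i.e. $A\in\{0,1\}^{n\times n}$. The same equivalence holds with the qualifier ''undirected'', the qualifier ''loopless'', or both, added simultaneously to ''quantum graph'' and to ''classical graph''.
   Context: $M_n=M_n(\mathbb C)$, with matrix units $E_{ij}$. For $A,B\in M_n$ with equal diagonals, $X_{A,B}(x)=\sum_{i\ne j}A_{ij}x_{jj}E_{ii}+\sum_{i,j}B_{ij}x_{ij}E_{ij}$; thus $X_{A,\operatorname{diag} A}(x)=\sum_{i,j}A_{ij}x_{jj}E_{ii}$. A quantum graph on $M_n$ is a linear map $G\colon M_n\to M_n$ (its adjacency operator) satisfying $\sum_{k} G(E_{ik})G(E_{kj})=G(E_{ij})$ for all $i,j$ (Schur idempotency, in the unnormalised convention) and $G(x^\dagger)=G(x)^\dagger$ for all $x$ (realness). It is undirected if $\mathrm{Tr}(G(x)y)=\mathrm{Tr}(xG(y))$ for all $x,y$ and loopless if $\sum_k G(E_{ik})E_{kj}=0$ for all $i,j$. A classical graph with adjacency matrix $A$ is undirected if $A=A^T$ and loopless if $A_{ii}=0$ for all $i$. *)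

(* Defs.v *)
From HB Require Import structures.
From mathcomp Require Import all_boot all_order all_algebra.
From mathcomp Require Import reals complex.

Set Implicit Arguments.
Unset Strict Implicit.
Unset Printing Implicit Defensive.

Import Order.TTheory GRing.Theory Num.Theory.
Local Open Scope ring_scope.
Local Open Scope sesquilinear_scope.

(* The complex field is C := R[i] for R : realType; [delta_mx i j] is the
   matrix unit E_ij, and [x ^t*] is the conjugate transpose of x.  Products of
   matrices are written [*m] since 'M_n is a unital ring only for n > 0. *)

Definition X_map (R : realType) (n : nat) (A B x : 'M[R[i]]_n) : 'M[R[i]]_n :=
  \sum_i \sum_(j | i != j) (A i j * x j j) *: delta_mx i i
  + \sum_i \sum_j (B i j * x i j) *: delta_mx i j.

Definition diag_part (R : realType) (n : nat) (A : 'M[R[i]]_n) : 'M[R[i]]_n :=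
  diag_mx (\row_i A i i).

Lemma X_map_diag_partE (R : realType) (n : nat) (A x : 'M[R[i]]_n) :
  X_map A (diag_part A) x =
  \sum_i \sum_j (A i j * x j j) *: delta_mx i i.
Proof.
rewrite /X_map -big_split; apply: eq_bigr => i _ /=.
rewrite [RHS](bigD1 i) //= addrC; congr (_ + _); last first.
  by apply: eq_bigl => j; rewrite eq_sym.
rewrite (bigD1 i) //= big1 ?addr0 => [|j ji]; first by rewrite !mxE eqxx mulr1n.
by rewrite !mxE eq_sym (negbTE ji) mulr0n mul0r scale0r.
Qed.

Record quantum_graph (R : realType) (n : nat)
    (G : 'M[R[i]]_n -> 'M[R[i]]_n) : Prop := QuantumGraph {
  qg_linear : linear G;
  qg_schur : forall i j : 'I_n,
    \sum_(k < n) G (delta_mx i k) *m G (delta_mx k j) = G (delta_mx i j);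
  qg_real : forall x : 'M[R[i]]_n, G (x ^t*) = (G x) ^t*
}.

Definition qundirected (R : realType) (n : nat)
    (G : 'M[R[i]]_n -> 'M[R[i]]_n) : Prop :=
  forall x y : 'M[R[i]]_n, \tr (G x *m y) = \tr (x *m G y).

Definition qloopless (R : realType) (n : nat)
    (G : 'M[R[i]]_n -> 'M[R[i]]_n) : Prop :=
  forall i j : 'I_n, \sum_(k < n) G (delta_mx i k) *m delta_mx k j = 0.

Definition classical_graph (R : realType) (n : nat) (A : 'M[R[i]]_n) : Prop :=
  forall i j : 'I_n, A i j = 0 \/ A i j = 1.

Definition cundirected (R : realType) (n : nat) (A : 'M[R[i]]_n) : Prop :=
  A = A^T.

Definition cloopless (R : realType) (n : nat) (A : 'M[R[i]]_n) : Prop :=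
  forall i : 'I_n, A i i = 0.

(* Main.v *)
Require Import Defs.
From mathcomp Require Import all_boot all_order all_algebra.
From mathcomp Require Import reals complex.

Import GRing.Theory.
Local Open Scope ring_scope.

(* X_{A, diag A}(x) is the diagonal matrix carrying A applied to the diagonal
   of x.  Hence X(E_kl) vanishes off the diagonal and X(E_kk) is the k-th
   column of A placed on the diagonal, so that Schur idempotency says that the
   entries of A are idempotent, symmetry of X that A is symmetric, and
   looplessness that A_kk E_kl = 0.  Realness is then automatic because 0 and 1
   are self-conjugate. *)

Lemma X_map_diag_mx (R : realType) (n : nat) (A x : 'M[R[i]]_n) :
  X_map A (diag_part A) x = diag_mx (\row_i \sum_j A i j * x j j).
Proof.
rewrite X_map_diag_partE diag_mx_sum_delta; apply: eq_bigr => i _.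
by rewrite mxE scaler_suml.
Qed.

Lemma X_map_delta (R : realType) (n : nat) (A : 'M[R[i]]_n) (k l : 'I_n) :
  X_map A (diag_part A) (delta_mx k l) =
  (k == l)%:R *: diag_mx (\row_i A i k).
Proof.
rewrite X_map_diag_mx -linearZ; congr diag_mx; apply/rowP => i; rewrite !mxE.
rewrite (bigD1 k) //= big1 => [|j jk]; first by rewrite mxE eqxx addr0 mulrC.
by rewrite mxE (negbTE jk) mulr0.
Qed.

Lemma linear_X_map (R : realType) (n : nat) (A : 'M[R[i]]_n) :
  linear (X_map A (diag_part A)).
Proof.
move=> a x y; rewrite !X_map_diag_mx -linearP; congr diag_mx.
apply/rowP => i; rewrite !mxE mulr_sumr -big_split; apply: eq_bigr => j _ /=.
by rewrite !mxE mulrDr mulrCA.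
Qed.

(** Every [k] other than [i] contributes a zero factor [X(E_ik)]. The remaining factor [X(E_ij)]
    also vanishes unless [i = j], when a diagonal matrix gets squared. *)
Lemma schur_X_map (R : realType) (n : nat) (A : 'M[R[i]]_n) (i j : 'I_n) :
  \sum_k X_map A (diag_part A) (delta_mx i k) *m
         X_map A (diag_part A) (delta_mx k j) =
  (i == j)%:R *: diag_mx (\row_m (A m i * A m i)).
Proof.
rewrite (bigD1 i) //= big1 ?addr0 => [|k ki]; last first.
  by rewrite X_map_delta eq_sym (negbTE ki) scale0r mul0mx.
rewrite !X_map_delta eqxx scale1r -scalemxAr mulmx_diag.
by congr (_ *: diag_mx _); apply/rowP => m; rewrite !mxE.
Qed.

Lemma quantum_graph_X_map (R : realType) (n : nat) (A : 'M[R[i]]_n) :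
  quantum_graph (X_map A (diag_part A)) <-> classical_graph A.
Proof.
split=> [[_ schur _] i j | clA].
  (* Entry [(i, i)] of the Schur identity for [E_jj] reads [A_ij ^ 2 = A_ij]. *)
  have /matrixP/(_ i i) := schur j j.
  rewrite schur_X_map X_map_delta eqxx !scale1r !mxE eqxx !mulr1n => idA.
  have /eqP : A i j * (A i j - 1) = 0 by rewrite mulrBr mulr1 idA subrr.
  by rewrite mulf_eq0 subr_eq0 => /orP[]/eqP; [left | right].
split=> [|i j|x]; first exact: linear_X_map.
  rewrite schur_X_map X_map_delta; congr (_ *: diag_mx _).
  by apply/rowP => m; rewrite !mxE; case: (clA m i) => ->; rewrite ?mulr0 ?mulr1.
(* Realness: both sides are diagonal, and conjugation fixes the entries of [A], so it acts only on
   the [x_kk]. *)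
rewrite !X_map_diag_mx; apply/matrixP => i j; rewrite !mxE eq_sym rmorphMn.
have [->|_] := eqVneq j i; last by rewrite !mulr0n.
rewrite rmorph_sum; congr (_ *+ _); apply: eq_bigr => k _.
by rewrite !mxE rmorphM; case: (clA i k) => ->; rewrite ?rmorph0 ?rmorph1.
Qed.

(** The trace form depends only on the diagonals of [x] and [y], and its matrix there is [A]; its
    symmetry is therefore that of [A]. *)
Lemma trace_X_mapl (R : realType) (n : nat) (A x y : 'M[R[i]]_n) :
  \tr (X_map A (diag_part A) x *m y) = \sum_i \sum_j A i j * x j j * y i i.
Proof.
rewrite X_map_diag_mx /mxtrace; apply: eq_bigr => i _.
by rewrite mul_diag_mx !mxE mulr_suml.
Qed.

Lemma qundirected_X_map (R : realType) (n : nat) (A : 'M[R[i]]_n) :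
  qundirected (X_map A (diag_part A)) <-> cundirected A.
Proof.
split=> [und | symA x y].
  apply/matrixP => i j; rewrite mxE.
  (* This pair isolates [A_ij] on the left and [A_ji] on the right. *)
  have := und (delta_mx j j) (delta_mx i i).
  rewrite [RHS]mxtrace_mulC !X_map_delta !eqxx !scale1r.
  rewrite /mxtrace (bigD1 i) //= [X in _ + X]big1 => [|k ki]; last first.
    by rewrite mul_diag_mx !mxE (negbTE ki) mulr0.
  rewrite (bigD1 j) //= [X in _ = _ + X]big1 => [|k kj]; last first.
    by rewrite mul_diag_mx !mxE (negbTE kj) mulr0.
  by rewrite !mul_diag_mx !mxE !eqxx !mulr1 !addr0.
(* By cyclicity of the trace the right side is the same form with [x] and [y] swapped. *)
rewrite [RHS]mxtrace_mulC !trace_X_mapl exchange_big.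
apply: eq_bigr => i _; apply: eq_bigr => j _ /=.
by rewrite mulrAC {1}symA mxE.
Qed.

Lemma qloopless_X_map (R : realType) (n : nat) (A : 'M[R[i]]_n) :
  qloopless (X_map A (diag_part A)) <-> cloopless A.
Proof.
(* Only [k = i] survives, and left multiplication by the diagonal matrix [X(E_ii)] scales row [i] of
   [E_ij] by [A_ii]. *)
have sumE i j : \sum_k X_map A (diag_part A) (delta_mx i k) *m delta_mx k j =
                A i i *: delta_mx i j.
  rewrite (bigD1 i) //= big1 ?addr0 => [|k ki]; last first.
    by rewrite X_map_delta eq_sym (negbTE ki) scale0r mul0mx.
  rewrite X_map_delta eqxx scale1r mul_diag_mx; apply/matrixP => k l.
  by rewrite !mxE; have [->|_] := eqVneq k i; rewrite ?mulr0.
split=> [lq i | lc i j]; last by rewrite sumE lc scale0r.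
have /matrixP/(_ i i) := lq i i.
by rewrite sumE !mxE !eqxx mulr1.
Qed.

Theorem corollary3p12 (R : realType) (n : nat) (n_ge2 : (2 <= n)%N)
    (A : 'M[R[i]]_n) :
  let X := X_map A (diag_part A) in
  [/\ quantum_graph X <-> classical_graph A,
      (quantum_graph X /\ qundirected X) <->
        (classical_graph A /\ cundirected A),
      (quantum_graph X /\ qloopless X) <->
        (classical_graph A /\ cloopless A)
    & (quantum_graph X /\ qundirected X /\ qloopless X) <->
        (classical_graph A /\ cundirected A /\ cloopless A)].
Proof.
move=> X.
have qgE := quantum_graph_X_map R n A.
have undE := qundirected_X_map R n A.
have loopE := qloopless_X_map R n A.
by split; rewrite /X; tauto.
Qed.
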